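(* Let $\mathbb{K}_2^n\subset\mathbb{R}^n$ be the second-order cone, let $c_1,c_2\in\mathbb{R}^n$ and $c_{1,0},c_{2,0}\in\{0,\pm1\}$ with $c_{1,0}\ge c_{2,0}$, and let $C_i:=\{x\in\mathbb{K}_2^n:\ c_i^\top x\ge c_{i,0}\}$ for $i\in\{1,2\}$. Suppose that $C_1\not\subseteq C_2$, $C_2\not\subseteq C_1$, and $C_i\cap\operatorname{int}\mathbb{K}_2^n\ne\emptyset$ for $i\in\{1,2\}$. Let $\beta>0$ be such that $\beta c_{1,0}\ge c_{2,0}$ and $\beta c_1-c_2\notin\pm\mathbb{K}_2^n$, and set $\mathcal{N}_1(\beta):=\|\beta\tilde c_1-\tilde c_2\|_2^2-(\beta c_{1,n}-c_{2,n})^2$. Consider the following three conditions on $x$: $$(A)\quad 2c_{2,0}-(\beta c_1+c_2)^\top x\le\sqrt{\big((\beta c_1-c_2)^\top x\big)^2+\mathcal{N}_1(\beta)\big(x_n^2-\|\tilde x\|_2^2\big)},$$ $$(B)\quad -2c_{2,0}+(\beta c_1+c_2)^\top x\le\sqrt{\big((\beta c_1-c_2)^\top x\big)^2+\mathcal{N}_1(\beta)\big(x_n^2-\|\tilde x\|_2^2\big)},$$ $$(C)\quad \mathcal{N}_1(\beta)\,x+2(c_2^\top x-c_{2,0})\begin{pmatrix}\beta\tilde c_1-\tilde c_2\\ -\beta c_{1,n}+c_{2,n}\end{pmatrix}\in\mathbb{K}_2^n .$$ If $x\in\mathbb{K}_2^n$ is a point for which $(B)$ holds, then $x$ satisfies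 $(A)$ if and only if $x$ satisfies the conic quadratic inequality $(C)$. Furthermore, if $(B)$ holds for all $x\in\overline{\mathrm{conv}}(C_1\cup C_2)$, then $(C)$ is valid for $\overline{\mathrm{conv}}(C_1\cup C_2)$ and implies $(A)$ (for $x\in\mathbb{K}_2^n$).
   Context: For $x\in\mathbb{R}^n$, $\tilde x:=(x_1;\dots;x_{n-1})$, and $c_{i,n}$ is the $n$-th entry of $c_i$, $\tilde c_i$ its first $n-1$ entries. $\mathbb{K}_2^n:=\{x\in\mathbb{R}^n:\|\tilde x\|_2\le x_n\}$. $\operatorname{int}$ denotes interior and $\overline{\mathrm{conv}}$ the closed convex hull; $v\notin\pm\mathbb{K}$ means $v\notin\mathbb{K}$ and $v\notin-\mathbb{K}$. An inequality is valid for a set if it holds at all points of the set. *)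

(* Defs.v *)
From HB Require Import structures.
From mathcomp Require Import all_boot all_order all_algebra.
From mathcomp Require Import boolp classical_sets reals topology normedtype.
From mathcomp Require Import convex.

Set Implicit Arguments.
Unset Strict Implicit.
Unset Printing Implicit Defensive.

Import Order.TTheory GRing.Theory Num.Theory.
Import numFieldNormedType.Exports.

Local Open Scope classical_set_scope.
Local Open Scope ring_scope.

(* The Euclidean norm is defined by hand because the norm `|x| that the library
   puts on matrices is the sup norm; both induce the topology used for
   interior and closure. *)
Definition norm2 {R : realType} {k : nat} (v : 'cV[R]_k) : R :=
  Num.sqrt (\sum_(i < k) v i 0 ^+ 2).

Definition dot {R : realType} {k : nat} (c x : 'cV[R]_k) : R := (c^T *m x) 0 0.

(* A vector of R^n, n >= 1, is a column of height m + 1 with m = n - 1. *)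
Definition initc {R : realType} {m : nat} (x : 'cV[R]_(m + 1)) : 'cV[R]_m :=
  usubmx x.

Definition lastc {R : realType} {m : nat} (x : 'cV[R]_(m + 1)) : R :=
  dsubmx x 0 0.

Definition soc {R : realType} {m : nat} : set 'cV[R]_(m + 1) :=
  [set x | norm2 (initc x) <= lastc x].

Definition soc_halfspace {R : realType} {m : nat} (c : 'cV[R]_(m + 1))
    (c0 : R) : set 'cV[R]_(m + 1) :=
  [set x | soc x /\ dot c x >= c0].

Definition closed_conv_hull {R : realType} {k : nat} (A : set 'cV[R]_k) :
    set 'cV[R]_k :=
  closure (smallest (@convex_set R 'cV[R]_k) A).

Definition N1 {R : realType} {m : nat} (beta : R) (c1 c2 : 'cV[R]_(m + 1)) : R :=
  norm2 (beta *: initc c1 - initc c2) ^+ 2 - (beta * lastc c1 - lastc c2) ^+ 2.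

Definition rootterm {R : realType} {m : nat} (beta : R)
    (c1 c2 x : 'cV[R]_(m + 1)) : R :=
  Num.sqrt (dot (beta *: c1 - c2) x ^+ 2
            + N1 beta c1 c2 * (lastc x ^+ 2 - norm2 (initc x) ^+ 2)).

Definition condA {R : realType} {m : nat} (beta : R) (c1 c2 : 'cV[R]_(m + 1))
    (c20 : R) (x : 'cV[R]_(m + 1)) : Prop :=
  2 * c20 - dot (beta *: c1 + c2) x <= rootterm beta c1 c2 x.

Definition condB {R : realType} {m : nat} (beta : R) (c1 c2 : 'cV[R]_(m + 1))
    (c20 : R) (x : 'cV[R]_(m + 1)) : Prop :=
  - (2 * c20) + dot (beta *: c1 + c2) x <= rootterm beta c1 c2 x.

Definition condC {R : realType} {m : nat} (beta : R) (c1 c2 : 'cV[R]_(m + 1))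
    (c20 : R) (x : 'cV[R]_(m + 1)) : Prop :=
  soc (N1 beta c1 c2 *: x
       + (2 * (dot c2 x - c20))
           *: col_mx (beta *: initc c1 - initc c2)
                     (- (beta * lastc c1) + lastc c2)%:M).

(* Main.v *)
Require Import Defs.
From mathcomp Require Import all_boot all_order all_algebra.
From mathcomp Require Import boolp classical_sets reals topology normedtype.
From mathcomp Require Import interval_inference convex ring lra.

Set Implicit Arguments.
Unset Strict Implicit.

Import Order.TTheory GRing.Theory Num.Theory.
Import numFieldNormedType.Exports.
Local Open Scope classical_set_scope.
Local Open Scope ring_scope.

(** Write d = beta c1 - c2, N for N1 beta c1 c2, q(x) = x_n^2 - |x~|^2 for the
    Lorentz quadratic form, w = (d~; - d_n) for the mirror image of d, and put
    s = d . x and t = 2 (c2 . x - c20).  The hypothesis that d lies neither in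
    the cone nor in its opposite says exactly that N = - q(d) = - q(w) is
    positive.  Conditions (A) and (B) are the bounds - (s + t) <= sqrt D and
    s + t <= sqrt D with D = s^2 + N q(x), and expanding the form along w gives
    (lemma [mink_condC])

      q(N x + t w) = N (D - (s + t)^2).

    So, for x in the cone (where D is nonnegative), the point tested by (C) has
    nonnegative q if and only if both (A) and (B) hold.  In particular (C) implies (A).  Conversely, nonnegative q only places
    the point in the cone or in its opposite.  The opposite is excluded by
    convexity: N x is in the cone, so if the negative of N x + t w were in it
    too, the sum - t w of these two vectors would be in the cone; since q is
    negative on w, this forces t = 0, and then the point is N x itself (lemma
    [soc_addZ]).

    For the closed convex hull, (A) holds on C1 and on C2: the defining
    inequality of either set bounds 2 c20 - (beta c1 + c2) . x by |s|, and
    |s| <= sqrt D.  Hence (C) holds on C1 and C2 by the equivalence.  As (C)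
    asks that an affine function of x lie in the cone, it defines a closed
    convex set, so it passes to the hull. *)

(** * Euclidean inner product and norm *)

Section Euclid.
Variables (R : realType) (k : nat).
Implicit Types (u v : 'cV[R]_k) (a : R).

Lemma dotE u v : dot u v = \sum_i u i 0 * v i 0.
Proof. by rewrite /dot mxE; apply: eq_bigr => i _; rewrite mxE. Qed.

Lemma dotC u v : dot u v = dot v u.
Proof. by rewrite !dotE; apply: eq_bigr => i _; rewrite mulrC. Qed.

Lemma dotDr u v1 v2 : dot u (v1 + v2) = dot u v1 + dot u v2.
Proof. by rewrite /dot mulmxDr mxE. Qed.

Lemma dotZr u a v : dot u (a *: v) = a * dot u v.
Proof. by rewrite /dot -scalemxAr mxE. Qed.

Lemma dotNr u v : dot u (- v) = - dot u v.
Proof. by rewrite -scaleN1r dotZr mulN1r. Qed.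

Lemma dotDl u1 u2 v : dot (u1 + u2) v = dot u1 v + dot u2 v.
Proof. by rewrite dotC dotDr !(dotC v). Qed.

Lemma dotZl a u v : dot (a *: u) v = a * dot u v.
Proof. by rewrite dotC dotZr dotC. Qed.

Lemma dotNl u v : dot (- u) v = - dot u v.
Proof. by rewrite dotC dotNr dotC. Qed.

Lemma dotvv_ge0 u : 0 <= dot u u.
Proof. by rewrite dotE; apply: sumr_ge0 => i _; rewrite -expr2 sqr_ge0. Qed.

Lemma dotvv_eq0 u : dot u u = 0 -> u = 0.
Proof.
rewrite dotE => /eqP; rewrite psumr_eq0 => [/allP u0|i _]; last first.
  by rewrite -expr2 sqr_ge0.
apply/matrixP => i j; rewrite ord1 mxE; apply/eqP.
by have := u0 i (mem_index_enum i); rewrite mulf_eq0 orbb.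
Qed.

Lemma norm2_ge0 u : 0 <= norm2 u.
Proof. exact: sqrtr_ge0. Qed.

Lemma norm2_sqr u : norm2 u ^+ 2 = dot u u.
Proof.
have -> : dot u u = \sum_(i < k) u i 0 ^+ 2 by rewrite dotE.
by rewrite sqr_sqrtr // sumr_ge0 // => i _; rewrite sqr_ge0.
Qed.

(** Cauchy-Schwarz, from the nonnegative square of |v| u - |u| v. *)
Lemma dot_le_norm2 u v : dot u v <= norm2 u * norm2 v.
Proof.
have nu := norm2_ge0 u; have nv := norm2_ge0 v.
have := dotvv_ge0 (norm2 v *: u - norm2 u *: v).
rewrite !(dotDl, dotDr, dotNl, dotNr, dotZl, dotZr) (dotC v u) -!norm2_sqr => h.
(* The square is 2 |u| |v| (|u| |v| - u . v), which is silent when a norm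
   vanishes. *)
have [u0|u_neq0] := eqVneq (norm2 u) 0.
  have -> : u = 0 by apply: dotvv_eq0; rewrite -norm2_sqr u0 expr0n.
  by rewrite -(scale0r v) dotZl mul0r mulr_ge0 // norm2_ge0.
have [v0|v_neq0] := eqVneq (norm2 v) 0.
  have -> : v = 0 by apply: dotvv_eq0; rewrite -norm2_sqr v0 expr0n.
  by rewrite -(scale0r u) dotZr mul0r mulr_ge0 // norm2_ge0.
have uv_gt0 : 0 < norm2 u * norm2 v.
  by rewrite mulr_gt0 // lt_neqAle eq_sym ?u_neq0 ?v_neq0.
by rewrite -(ler_pM2l uv_gt0); nra.
Qed.

Lemma norm2D u v : norm2 (u + v) <= norm2 u + norm2 v.
Proof.
rewrite -(ler_pXn2r (ltn0Sn 1)) ?nnegrE ?addr_ge0 ?norm2_ge0 //.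
rewrite sqrrD !norm2_sqr dotDl !dotDr (dotC v u).
by have := dot_le_norm2 u v; lra.
Qed.

Lemma norm2Z a u : norm2 (a *: u) = `|a| * norm2 u.
Proof.
apply/eqP; rewrite -(eqrXn2 (ltn0Sn 1)) ?mulr_ge0 ?norm2_ge0 //.
by rewrite exprMn !norm2_sqr dotZl dotZr real_normK ?num_real // expr2 mulrA.
Qed.

Lemma dot_continuous u : continuous (fun x : 'cV[R]_k => dot u x).
Proof.
have -> : (fun x : 'cV[R]_k => dot u x) = (fun x => \sum_i u i 0 * x i 0).
  by apply/funext => x; rewrite dotE.
apply: (@continuous_big R 'I_k +%R); first by move=> z; apply: add_continuous.
move=> i _ x; apply: (@continuousM R 'cV[R]_k (fun=> u i 0) (fun y => y i 0)).
  exact: cst_continuous.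
exact: coord_continuous.
Qed.

End Euclid.

(** * The Lorentz form and the second-order cone *)

Section Cone.
Variables (R : realType) (m : nat).
Implicit Types (x y w d c : 'cV[R]_(m + 1)) (a t : R).

Definition mink x y : R := lastc x * lastc y - dot (initc x) (initc y).

(** The mirror image of d: pairing with it for the Lorentz form is, up to sign,
    the Euclidean inner product with d. *)
Definition mirror d : 'cV[R]_(m + 1) := col_mx (initc d) (- lastc d)%:M.

Lemma initcD x y : initc (x + y) = initc x + initc y.
Proof. by apply/matrixP => i j; rewrite !mxE. Qed.

Lemma initcZ a x : initc (a *: x) = a *: initc x.
Proof. by apply/matrixP => i j; rewrite !mxE. Qed.

Lemma initcN x : initc (- x) = - initc x.
Proof. by apply/matrixP => i j; rewrite !mxE. Qed.

Lemma lastcD x y : lastc (x + y) = lastc x + lastc y.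
Proof. by rewrite /lastc !mxE. Qed.

Lemma lastcZ a x : lastc (a *: x) = a * lastc x.
Proof. by rewrite /lastc !mxE. Qed.

Lemma lastcN x : lastc (- x) = - lastc x.
Proof. by rewrite /lastc !mxE. Qed.

Lemma initc_mirror d : initc (mirror d) = initc d.
Proof. exact: col_mxKu. Qed.

Lemma lastc_mirror d : lastc (mirror d) = - lastc d.
Proof. by rewrite /lastc /mirror col_mxKd mxE eqxx. Qed.

Lemma dot_initc_lastc c x :
  dot c x = dot (initc c) (initc x) + lastc c * lastc x.
Proof.
rewrite !dotE big_split_ord /= big_ord1 /lastc !mxE.
by congr (_ + _); apply: eq_bigr => i _; rewrite !mxE.
Qed.

Lemma minkxx x : mink x x = lastc x ^+ 2 - norm2 (initc x) ^+ 2.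
Proof. by rewrite norm2_sqr. Qed.

Lemma mink_addZ x w a t : mink (a *: x + t *: w) (a *: x + t *: w) =
  a ^+ 2 * mink x x + 2 * a * t * mink x w + t ^+ 2 * mink w w.
Proof.
rewrite /mink !initcD !lastcD !initcZ !lastcZ !(dotDl, dotDr, dotZl, dotZr).
by rewrite (dotC (initc w)); ring.
Qed.

Lemma mink_mirror x d : mink x (mirror d) = - dot d x.
Proof.
by rewrite /mink initc_mirror lastc_mirror dot_initc_lastc dotC; ring.
Qed.

Lemma mink_mirror_mirror d : mink (mirror d) (mirror d) = mink d d.
Proof. by rewrite /mink initc_mirror lastc_mirror mulrNN. Qed.

Lemma socD x y : soc x -> soc y -> soc (x + y).
Proof.
rewrite /soc /= initcD lastcD => sx sy.
by apply: (le_trans (norm2D _ _)); apply: lerD.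
Qed.

Lemma socZ a x : 0 <= a -> soc x -> soc (a *: x).
Proof.
by move=> a0 sx; rewrite /soc /= initcZ lastcZ norm2Z ger0_norm // ler_wpM2l.
Qed.

Lemma socE x : soc x <-> 0 <= lastc x /\ 0 <= mink x x.
Proof.
rewrite minkxx subr_ge0 /soc /=; split=> [sx|[lx]].
  have lx := le_trans (norm2_ge0 _) sx.
  by split=> //; rewrite ler_pXn2r ?nnegrE ?norm2_ge0.
by rewrite ler_pXn2r ?nnegrE ?norm2_ge0.
Qed.

Lemma soc_or_opp x : 0 <= mink x x -> soc x \/ soc (- x).
Proof.
move=> qx; have [lx|lx] := leP 0 (lastc x).
  by left; apply/socE.
right; apply/socE; rewrite lastcN oppr_ge0; split; first exact: ltW.
by rewrite /mink initcN lastcN dotNl dotNr opprK mulrNN.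
Qed.

(** A line through a point of the cone, in a direction on which the form is
    negative, cannot reach the opposite cone at another point: the difference of
    the two points would be a nonzero multiple of the direction lying in the
    cone, where the form is nonnegative. *)
Lemma soc_addZ x w t : mink w w < 0 -> soc x ->
  0 <= mink (x + t *: w) (x + t *: w) -> soc (x + t *: w).
Proof.
move=> qw sx /soc_or_opp[//|sN].
have /socE[_] : soc (- t *: w).
  by have := socD sx sN; rewrite opprD addrA subrr add0r scaleNr.
have [-> _|t0] := eqVneq t 0; first by rewrite scale0r addr0.
have := mink_addZ 0 w 0 (- t).
rewrite scale0r add0r => ->.
rewrite expr0n /= mulr0 !mul0r !add0r sqrrN.
by rewrite pmulr_rge0 ?exprn_even_gt0 // leNgt qw.
Qed.

Lemma mink_lt0 d : ~ soc d -> ~ (-%R @` soc) d -> mink d d < 0.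
Proof.
move=> dK dNK; rewrite ltNge; apply/negP => /soc_or_opp[//|sN].
by apply: dNK; exists (- d); rewrite ?opprK.
Qed.

Lemma lastc_continuous : continuous (@lastc R m).
Proof.
have -> : @lastc R m = (fun x => x (rshift m 0) 0).
  by apply/funext => x; rewrite /lastc mxE.
exact: coord_continuous.
Qed.

Lemma minkxx_continuous : continuous (fun x => mink x x).
Proof.
(* On the diagonal the form is 2 x_n^2 - |x|^2, with the full Euclidean norm. *)
have -> : (fun x => mink x x) =
    (fun x => 2 * (lastc x * lastc x) - \sum_i x i 0 * x i 0).
  by apply/funext => x; rewrite -dotE dot_initc_lastc /mink; ring.
move=> x; apply: (@continuousB _ _ _ (fun y => 2 * (lastc y * lastc y))
  (fun y => \sum_i y i 0 * y i 0)).
  apply: (@continuousM R _ (fun=> 2) (fun y => lastc y * lastc y)).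
    exact: cst_continuous.
  by apply: (@continuousM R _ (@lastc R m) (@lastc R m)); exact: lastc_continuous.
move: x; apply: (@continuous_big R 'I_(m + 1) +%R).
  by move=> z; apply: add_continuous.
move=> i _ y.
by apply: (@continuousM R 'cV[R]_(m + 1) (fun z => z i 0) (fun z => z i 0));
  exact: coord_continuous.
Qed.

Lemma closed_soc : closed (@soc R m).
Proof.
have -> : @soc R m =
    @lastc R m @^-1` [set r | 0 <= r]
    `&` (fun x => mink x x) @^-1` [set r | 0 <= r].
  by apply/seteqP; split => x /socE.
apply: closedI.
- by move/continuous_closedP: lastc_continuous; apply; exact: closed_ge.
- by move/continuous_closedP: minkxx_continuous; apply; exact: closed_ge.
Qed.

End Cone.

(** * Closed convex hulls *)

Lemma closed_conv_hull_sub (R : realType) (k : nat) (A B : set 'cV[R]_k) :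
  closed B -> convex_set (B : set (convex_lmodType 'cV[R]_k)) ->
  A `<=` B -> closed_conv_hull A `<=` B.
Proof.
move=> cB xB AB; rewrite /closed_conv_hull.
have -> : B = closure B by apply/closure_id.
apply: closureS.
exact: smallest_sub.
Qed.

Lemma sub_closed_conv_hull (R : realType) (k : nat) (A : set 'cV[R]_k) :
  A `<=` closed_conv_hull A.
Proof. by move=> x Ax; apply: subset_closure; apply: sub_smallest Ax. Qed.

(** * The conic inequality *)

Section Disjunction.
Variables (R : realType) (m : nat) (beta c20 : R) (c1 c2 : 'cV[R]_(m + 1)).
Implicit Types x : 'cV[R]_(m + 1).

Let d := beta *: c1 - c2.
Let N := N1 beta c1 c2.
Let slack x := 2 * (dot c2 x - c20).
Let point x := N *: x + slack x *: mirror d.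
Let disc x := dot d x ^+ 2 + N * mink x x.

Lemma N1E : N = - mink d d.
Proof.
by rewrite minkxx opprB /d initcD initcZ initcN lastcD lastcZ lastcN.
Qed.

Lemma condCE x : condC beta c1 c2 c20 x = soc (point x).
Proof.
rewrite /condC /point /mirror /d initcD initcZ initcN lastcD lastcZ lastcN.
by rewrite opprD opprK.
Qed.

Lemma mink_condC x :
  mink (point x) (point x) = N * (disc x - (dot d x + slack x) ^+ 2).
Proof.
rewrite /point mink_addZ mink_mirror mink_mirror_mirror /disc.
have -> : mink d d = - N by rewrite N1E opprK.
by ring.
Qed.

Lemma condAE x :
  condA beta c1 c2 c20 x = (- (dot d x + slack x) <= Num.sqrt (disc x)) :> Prop.
Proof.
rewrite /condA /rootterm -minkxx -/N -/d -/(disc x); congr (is_true (_ <= _)).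
by rewrite /slack /d !(dotDl, dotNl); ring.
Qed.

Lemma condBE x :
  condB beta c1 c2 c20 x = (dot d x + slack x <= Num.sqrt (disc x)) :> Prop.
Proof.
rewrite /condB /rootterm -minkxx -/N -/d -/(disc x); congr (is_true (_ <= _)).
by rewrite /slack /d !(dotDl, dotNl); ring.
Qed.

Hypothesis N_gt0 : 0 < N.

Lemma dot_sqr_le_disc x : soc x -> dot d x ^+ 2 <= disc x.
Proof. by move=> /socE[_ qx]; rewrite lerDl mulr_ge0 // ltW. Qed.

Lemma condC_condA x : condC beta c1 c2 c20 x -> condA beta c1 c2 c20 x.
Proof.
rewrite condCE condAE => /socE[_]; rewrite mink_condC pmulr_rge0 // subr_ge0.
move=> /ler_wsqrtr; rewrite sqrtr_sqr; apply: le_trans.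
by rewrite -normrN ler_norm.
Qed.

Lemma condAB_condC x : soc x ->
  condA beta c1 c2 c20 x -> condB beta c1 c2 c20 x -> condC beta c1 c2 c20 x.
Proof.
move=> sx; rewrite condAE condBE condCE => hA hB.
apply: soc_addZ.
- by rewrite mink_mirror_mirror -oppr_gt0 -N1E.
- exact: socZ (ltW N_gt0) sx.
- rewrite -/(point x) mink_condC pmulr_rge0 // subr_ge0.
  have D0 : 0 <= disc x := le_trans (sqr_ge0 _) (dot_sqr_le_disc sx).
  by rewrite -(ler_sqrt _ D0) sqrtr_sqr ler_norml lerNl hA.
Qed.

Lemma condA_soc_halfspace c10 x : c20 <= beta * c10 -> 0 < beta ->
  (soc_halfspace c1 c10 `|` soc_halfspace c2 c20) x -> condA beta c1 c2 c20 x.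
Proof.
move=> bc b0 Cx; have sx : soc x by case: Cx => -[].
rewrite condAE; have := ler_wsqrtr (dot_sqr_le_disc sx).
rewrite sqrtr_sqr; apply: le_trans.
have := ler_norm (dot d x); have := ler_norm (- dot d x); rewrite normrN.
case: Cx => -[_ cx]; last by rewrite /slack; lra.
(* Here the defining inequality enters multiplied by beta, and is compared with
   c20 by means of c20 <= beta c10. *)
have := ler_wpM2l (ltW b0) cx.
by rewrite /slack /d !(dotDl, dotNl, dotZl); lra.
Qed.

Lemma closed_condC : closed [set x | condC beta c1 c2 c20 x].
Proof.
have -> : [set x | condC beta c1 c2 c20 x] = point @^-1` soc.
  by apply/funext => x /=; rewrite condCE.
suff /continuous_closedP : continuous point by apply; exact: closed_soc.
move=> x; apply: (@continuousD _ _ _ (fun y => N *: y)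
  (fun y => slack y *: mirror d)).
  exact: scaler_continuous.
apply: (@continuousZ _ _ _ slack (fun=> mirror d)); last exact: cst_continuous.
apply: (@continuousM R _ (fun=> 2) (fun y => dot c2 y - c20)).
  exact: cst_continuous.
apply: (@continuousB _ _ _ (dot c2) (fun=> c20)); last exact: cst_continuous.
exact: dot_continuous.
Qed.

Lemma convex_condC : convex_set
  ([set x | condC beta c1 c2 c20 x] : set (convex_lmodType 'cV[R]_(m + 1))).
Proof.
move=> x y l; rewrite !inE /= !condCE => sx sy.
set a := l%:num : R.
have -> : point (conv l x y) = a *: point x + (1 - a) *: point y.
  have -> : conv l x y = a *: x + (1 - a) *: y by [].
  rewrite /point /slack dotDr !dotZr.
  by apply/matrixP => i j; rewrite !mxE; ring.
have [a_ge0 a_le1] : 0 <= a /\ a <= 1 by rewrite /a ge0 le1.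
by apply: socD; apply: socZ; rewrite ?subr_ge0.
Qed.

End Disjunction.

Theorem proposition2 (R : realType) (m : nat) (c1 c2 : 'cV[R]_(m + 1))
    (c10 c20 : R)
    (hc10 : c10 \in [:: 0; 1; -1]) (hc20 : c20 \in [:: 0; 1; -1])
    (hc : c10 >= c20)
    (h12 : ~ (soc_halfspace c1 c10 `<=` soc_halfspace c2 c20))
    (h21 : ~ (soc_halfspace c2 c20 `<=` soc_halfspace c1 c10))
    (hint1 : soc_halfspace c1 c10 `&` interior soc !=set0)
    (hint2 : soc_halfspace c2 c20 `&` interior soc !=set0)
    (beta : R) (hbeta : 0 < beta)
    (hbetac : beta * c10 >= c20)
    (hK : ~ soc (beta *: c1 - c2))
    (hNK : ~ (-%R @` soc) (beta *: c1 - c2)) :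
  (forall x, soc x -> condB beta c1 c2 c20 x ->
     (condA beta c1 c2 c20 x <-> condC beta c1 c2 c20 x))
  /\
  ((forall x, closed_conv_hull (soc_halfspace c1 c10 `|` soc_halfspace c2 c20) x ->
      condB beta c1 c2 c20 x) ->
   (forall x, closed_conv_hull (soc_halfspace c1 c10 `|` soc_halfspace c2 c20) x ->
      condC beta c1 c2 c20 x)
   /\
   (forall x, soc x -> condC beta c1 c2 c20 x -> condA beta c1 c2 c20 x)).
Proof.
have N_gt0 : 0 < N1 beta c1 c2 by rewrite N1E oppr_gt0; apply: mink_lt0.
split=> [x sx hB|hB].
  split=> [hA|]; [exact: condAB_condC | exact: condC_condA].
split=> [x|x _]; last exact: condC_condA.
apply: (@closed_conv_hull_sub R _ _ [set y | condC beta c1 c2 c20 y]).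
- exact: closed_condC.
- exact: convex_condC.
- move=> y Cy; apply: condAB_condC => //.
  + by case: Cy => -[].
  + exact: condA_soc_halfspace Cy.
  + exact/hB/sub_closed_conv_hull.
Qed.
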